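(* The class of all IP loops has the Finite Embedding Property: for every IP loop $(G,\cdot)$ and every nonempty finite subset $X\subseteq G$ there exists a finite IP loop $(H,* )$ with $X\subseteq H$ such that $x\cdot y = x*y$ for all $x,y\in X$ with $x\cdot y\in X$.
   Context: An IP loop (loop with the inverse property) is a loop in which every element $x$ has a two-sided inverse $x^{-1}$ and the identities $x^{-1}(xy)=y=(yx)x^{-1}$ hold. *)

(* Defs.v *)
From Stdlib Require Import List FinFun.
Export ListNotations.

Definition is_loop {G : Type} (m : G -> G -> G) : Prop :=
  (exists e : G, forall x, m e x = x /\ m x e = x) /\
  (forall a b : G, exists! x, m a x = b) /\
  (forall a b : G, exists! y, m y a = b).

Definition is_IP_loop {G : Type} (m : G -> G -> G) : Prop :=
  is_loop m /\
  exists e : G, (forall x, m e x = x /\ m x e = x) /\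
    forall x : G, exists x' : G,
      m x x' = e /\ m x' x = e /\
      forall y : G, m x' (m x y) = y /\ m (m y x) x' = y.

(* Main.v *)
(** Encode x y = w^-1 as a triple (x, y, w).  On the non-identity elements, an
    IP loop is a partial set of triples, closed under the rotation (y, w, x) and
    the reversal (y^-1, x^-1, w^-1), in which each pair (x, y) with y <> x^-1
    occurs exactly once.  Hence a finite IP loop may be altered by a trade:
    remove a closed set of triples and insert another one using the same pairs.

    The finite set X generates a finite partial structure T, whose elements are
    mapped to independent elements of a group A = Z_4^I x Z_2^K of exponent 4.
    If x, y, w have pairwise different classes {x, x^-1}, put p = -(x+y),
    q = -(y+w), r = -(w+x); if moreover (p, q, r) is a triple, then
      (x,y,p), (y,w,q), (w,x,r), (p,q,r)  may be traded for
      (x,y,w), (y,p,q), (w,q,r), (x,r,p)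
    (a Pasch switch).  In A one has p+q+r = -2(x+y+w), an element of order at
    most 2; twisting the sum by 2(x+y+w) on the classes modulo 2A of p, q, r
    first makes (p, q, r) a triple.

    Triples (x,x,w) are obtained by a last trade, after adjoining to T fresh
    elements with the same double z = 2x as x.  For w <> x, one fresh a with
    a^-1 = xw = wx suffices: (x,x,z), (a,a,z), (x,w,a), (w,x,a) are traded for
    (x,x,w), (a,a,w), (x,z,a), (z,x,a).  For w = x, two fresh elements a, b with
    (x,a,b) a triple generate a quaternion-like configuration, and
    (x,x,z), (a,a,z), (b,b,z), (x,a,b) are traded for
    (x,x,x), (a,a,a), (b,b,b), (z,x,a), (z,a,b), (z,b,x). *)

Require Defs.
From HB Require Import structures.
From mathcomp Require Import all_boot all_algebra ring.
From mathcomp Require Import boolp.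

Set Implicit Arguments.
Unset Strict Implicit.
Unset Printing Implicit Defensive.

Import GRing.Theory.
Local Open Scope ring_scope.

(** * Trades in IP loops on an abelian group with the same inverses *)

(** Trades keep the neutral element and the inverses, so all the loops in play live on one group
    [A], with neutral element 0 and inverse [- x]. *)
Definition ip_op (A : zmodType) (op : A -> A -> A) : Prop :=
  (forall x, op 0 x = x /\ op x 0 = x) /\
  (forall x y, op (- x) (op x y) = y /\ op (op y x) (- x) = y).

Lemma ip_opN (A : zmodType) (op : A -> A -> A) u v :
  ip_op op -> - op u v = op (- v) (- u).
Proof.
move=> [_ ip].
have e1 : op v (- op u v) = - u by rewrite -{1}(ip u v).1 (ip (op u v) (- u)).2.
by rewrite -e1 (ip v (- op u v)).1.
Qed.

(** [N] is the set of inserted triples. By the last hypothesis the pairs occurring in [N] are stable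
    under rotation of the old triples (u, v, -uv), so that old triples are removed as a whole. The
    right inverse property follows from the left one because negation still reverses products. *)
Lemma ip_op_trade (A : zmodType) (op : A -> A -> A) (N : A -> A -> A -> Prop) :
  ip_op op ->
  (forall u v t, N u v t -> u <> 0) ->
  (forall u v t, N u v t -> N v t u) ->
  (forall u v t, N u v t -> N (- v) (- u) (- t)) ->
  (forall u v t t', N u v t -> N u v t' -> t = t') ->
  (forall u v t, N u v t -> exists s, N v (- op u v) s) ->
  exists op' : A -> A -> A,
    [/\ ip_op op', (forall u v t, N u v t -> op' u v = - t)
      & (forall u v, ~ (exists t, N u v t) -> op' u v = op u v)].
Proof.
move=> ipop N0 Nrot Nrev Nfun Nbase.
pose op' u v := if pselect (exists t, N u v t) is left h
                then - sval (cid h) else op u v.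
have opN u v t : N u v t -> op' u v = - t.
  move=> Nuvt; rewrite /op'; case: pselect => [h|[]]; last by exists t.
  by congr (- _); apply: Nfun Nuvt; exact: svalP (cid h).
have opE u v : ~ (exists t, N u v t) -> op' u v = op u v.
  by move=> h; rewrite /op'; case: pselect.
have [ip0 ip] := ipop.
have op'N u v : - op' u v = op' (- v) (- u).
  have [[t Nt]|h] := pselect (exists t, N u v t).
    by rewrite (opN _ _ _ Nt) (opN _ _ _ (Nrev _ _ _ Nt)).
  rewrite (opE u v) // (opE (- v) (- u)) ?(ip_opN u v ipop) //.
  move=> [t /Nrev]; rewrite !opprK => Nt.
  by apply: h; exists (- t).
have op'K u v : op' (- u) (op' u v) = v.
  have [[t Nt]|h] := pselect (exists t, N u v t).
    by rewrite (opN _ _ _ Nt) (opN _ _ _ (Nrot _ _ _ (Nrev _ _ _ Nt))) opprK.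
  (* If the pair (-u, uv) occurred in [N], a reversal followed by a rotation of the old triple would
     put (u, v) there. *)
  rewrite (opE u v) // (opE (- u)) ?(ip u v).1 // => -[t /Nrev /Nbase [s]].
  by rewrite opprK (ip_opN _ _ ipop) opprK (ip u v).1 => Ns; apply: h; exists s.
exists op'; split => //; split => [x|x y]; split => //.
- rewrite opE; first by have [] := ip0 x.
  by move=> [t /N0].
- rewrite opE; first by have [] := ip0 x.
  by move=> [t /Nrot /N0].
- by apply: oppr_inj; rewrite op'N (op'N y x) op'K.
Qed.

(** * The twist and the Pasch switch in a group of exponent 4 *)

Section Trades.

(* Only the additive group of [A] matters: it is a ring so that the tactic [ring]
   applies. *)
Variables (A : comPzRingType) (E : zmodType) (pr : {additive A -> E}).
Variables (par : {additive E -> 'Z_2}) (J : Type) (inv : J -> J) (g : J -> A).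

(** [pr] remembers a generator only up to inversion. The parity [par] separates generators, which
    are odd, from doubles and from sums of two generators. *)
Hypothesis A4 : forall u : A, u *+ 4 = 0.
Hypothesis E2 : forall e : E, e + e = 0.
Hypothesis gN : forall j, g (inv j) = - g j.
Hypothesis g_inj : injective g.
Hypothesis par_g : forall j, par (pr (g j)) = 1.
Hypothesis pr_inj : forall j k, pr (g j) = pr (g k) -> k = j \/ k = inv j.
Hypothesis pr_sum : forall j k j' k',
  pr (g j) + pr (g k) = pr (g j') + pr (g k') -> pr (g j) <> pr (g k) ->
  (pr (g j) = pr (g j') /\ pr (g k) = pr (g k')) \/
  (pr (g j) = pr (g k') /\ pr (g k) = pr (g j')).

Variable T : J -> J -> J -> Prop.
Hypothesis T_rot : forall x y w, T x y w -> T y w x.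
Hypothesis T_rev : forall x y w, T x y w -> T (inv y) (inv x) (inv w).
Hypothesis T_fun : forall x y w w', T x y w -> T x y w' -> w = w'.
Hypothesis T_cls : forall x y w, T x y w -> pr (g x) <> pr (g y).
(** Under these equations (x,y,w) and (x^-1,y^-1,w^-1) have the same p and q, and their switches
    complete the pair (p, q) by y and by y^-1 respectively. *)
Hypothesis T_sign : forall x y w, T x y w -> T (inv x) (inv y) (inv w) ->
  g x *+ 2 = g y *+ 2 -> g y *+ 2 = g w *+ 2 -> inv y = y.

(** Lets [ring] prove identities modulo 4, once the difference [c *+ 4] of the two sides is
    supplied. *)
Let eq4 (c a b : A) : a = b + c *+ 4 -> a = b.
Proof. by rewrite A4 addr0. Qed.
Arguments eq4 c {a b}.

Let dbl (a b : A) : a + b = - a - b -> a *+ 2 = b *+ 2.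
Proof.
move=> /eqP; rewrite -subr_eq0 => /eqP h; apply: (eq4 (- b)).
by rewrite -[b *+ 2]addr0 -h; ring.
Qed.

Let EN (e : E) : - e = e.
Proof. by apply/eqP; rewrite -subr_eq0 -opprD E2 oppr0. Qed.

Let EK (e f : E) : e + f = 0 -> e = f.
Proof. by move=> /eqP; rewrite addr_eq0 EN => /eqP. Qed.

Let prg2 j : pr (g j *+ 2) = 0.
Proof. by rewrite raddfMn /= mulr2n E2. Qed.

Let T_rot2 x y w : T x y w -> T w x y.
Proof. by move=> /T_rot/T_rot. Qed.

Let T_rev' x y w : T x y w -> T (inv w) (inv y) (inv x).
Proof. by move=> /T_rev/T_rot2. Qed.

Let pr_double j k : pr (g j) = pr (g k) -> g j *+ 2 = g k *+ 2.
Proof.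
by move=> /pr_inj[->|->] //; rewrite gN; apply: (eq4 (g j)); ring.
Qed.

Let T_pr x y w x' y' w' : T x y w -> T x' y' w' ->
  pr (g x) + pr (g y) = pr (g x') + pr (g y') ->
  pr (g y) + pr (g w) = pr (g y') + pr (g w') ->
  [/\ pr (g x) = pr (g x'), pr (g y) = pr (g y') & pr (g w) = pr (g w')].
Proof.
move=> t t' exy eyw.
have nxy := T_cls t; have nyw := T_cls (T_rot t); have nwx := T_cls (T_rot2 t).
have nxy' := T_cls t'.
case: (pr_sum exy nxy) (pr_sum eyw nyw) => [[e1 e2]|[e1 e2]] [[e3 e4]|[e3 e4]].
- by split.
- by split=> //; congruence.
- by congruence.
- by congruence.
Qed.

(* Both arguments of a twisted sum have even parity, so that sums with some [g x]
   as a summand are not affected. *)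
Let twist (u v t : A) : Prop := exists x y w, [/\ T x y w,
  pr u = pr (g x) + pr (g y), pr v = pr (g y) + pr (g w)
  & t = - (u + v) + (g x + g y + g w) *+ 2].

(** The correction 2(x+y+w) is killed by [pr], so the trade preserves classes, and it depends on the
    classes only, as 2x = -2x. At p and q the product becomes -(x+2y+w) - 2(x+y+w) = x+w = -r modulo
    4. *)
Lemma twisted_op : exists op : A -> A -> A,
  [/\ ip_op op,
      (forall x y w, T x y w -> op (- (g x + g y)) (- (g y + g w)) = g x + g w)
    & (forall u v, par (pr u) = 1 \/ par (pr v) = 1 -> op u v = u + v)].
Proof.
have prs u v x y w : pr u = pr (g x) + pr (g y) -> pr v = pr (g y) + pr (g w) ->
    pr (- (u + v)) = pr (g w) + pr (g x).
  by move=> eu ev; rewrite raddfN raddfD /= eu ev EN -addrA (addrA (pr (g y))) E2 add0r addrC.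
have [] := @ip_op_trade A +%R twist.
- split=> [x|x y]; first by rewrite add0r addr0.
  by rewrite addKr addrK.
- move=> u v t [x [y [w [t1 eu _ _]]]] u0.
  by apply: (T_cls t1); apply: EK; rewrite -eu u0 raddf0.
- move=> u v t [x [y [w [t1 eu ev et]]]]; exists y, w, x; split=> //.
  + exact: T_rot.
  + rewrite et raddfD /= (prs _ _ _ _ _ eu ev) [pr (_ *+ 2)]raddfMn /= mulr2n E2.
    by rewrite addr0.
  + by rewrite et; ring.
- move=> u v t [x [y [w [t1 eu ev et]]]]; exists (inv w), (inv y), (inv x); split.
  + exact: T_rev'.
  + by rewrite raddfN /= ev !gN !raddfN /= opprD addrC.
  + by rewrite raddfN /= eu !gN !raddfN /= opprD addrC.
  + by rewrite et !gN; ring.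
- move=> u v t t' [x [y [w [t1 eu ev ->]]]] [x' [y' [w' [t1' eu' ev' ->]]]].
  have [e1 e2 e3] := T_pr t1 t1' (etrans (esym eu) eu') (etrans (esym ev) ev').
  by rewrite !mulrnDl (pr_double e1) (pr_double e2) (pr_double e3).
- move=> u v t [x [y [w [t1 eu ev et]]]].
  exists (- (v + - (u + v)) + (g y + g w + g x) *+ 2), y, w, x; split=> //.
    exact: T_rot.
  exact: prs eu ev.
move=> op [ipop opN opE]; exists op; split=> //.
- move=> x y w t1.
  rewrite (opN _ _ (- (g x + g w))) ?opprK //; exists x, y, w; split=> //.
  + by rewrite raddfN raddfD /= EN.
  + by rewrite raddfN raddfD /= EN.
  + by apply: (eq4 (- (g x + g y + g w))); ring.
- move=> u v h; rewrite opE // => -[t [x [y [w [_ eu ev _]]]]].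
  by case: h => /eqP; rewrite ?eu ?ev raddfD /= !par_g.
Qed.

(** Besides (x,y,w), only the rotations of (y,p,q) are listed: (w,q,r) and (x,r,p) arise from the
    rotations of (x,y,w). *)
Let pasch (u v t : A) : Prop := exists x y w, T x y w /\
  let p := - (g x + g y) in let q := - (g y + g w) in
  [\/ [/\ u = g x, v = g y & t = g w], [/\ u = g y, v = p & t = q],
      [/\ u = p, v = q & t = g y] | [/\ u = q, v = g y & t = p]].

(** The switches leave the pairs (j,j), (2j,j) and (j,2j) alone, so these products stay additive;
    the last trade relies on them. *)
Lemma pasch_op : exists op : A -> A -> A,
  [/\ ip_op op, (forall x y w, T x y w -> op (g x) (g y) = - g w)
    & (forall j, [/\ op (g j) (g j) = g j *+ 2,
        op (g j *+ 2) (g j) = g j *+ 3 & op (g j) (g j *+ 2) = g j *+ 3])].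
Proof.
have [op1 [ip1 op1T op1E]] := twisted_op.
have parN x y : par (pr (- (g x + g y))) = 0.
  by rewrite raddfN raddfD /= EN raddfD /= !par_g; apply/val_inj.
have par1 x : par (pr (g x)) <> 0 by rewrite par_g.
have par1' x : 0 <> par (pr (g x)) by rewrite par_g.
have [] := @ip_op_trade A op1 pasch.
- exact: ip1.
- move=> u v t [x [y [w [t1 h]]]] u0.
  have pr0 a b c : T a b c -> - (g a + g b) <> 0.
    move=> /T_cls n /(congr1 pr); rewrite raddfN raddfD /= EN raddf0 => /EK.
    exact: n.
  have g0 a : g a <> 0 by move=> e; apply: (par1 a); rewrite e !raddf0.
  by case: h u0 => -[-> _ _]; [exact: g0|exact: g0|exact: pr0 t1|
    exact: pr0 (T_rot t1)].
- move=> u v t [x [y [w [t1 [] [-> -> ->]]]]].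
  + by exists y, w, x; split; [exact: T_rot|apply: Or41].
  + by exists x, y, w; split=> //; apply: Or43.
  + by exists x, y, w; split=> //; apply: Or44.
  + by exists x, y, w; split=> //; apply: Or42.
- move=> u v t [x [y [w [t1 h]]]].
  case: h => -[-> -> ->].
  + exists (inv y), (inv x), (inv w); split; first exact: T_rev.
    by apply: Or41; rewrite !gN.
  + exists (inv w), (inv y), (inv x); split; first exact: T_rev'.
    by apply: Or44; rewrite !gN; split => //; ring.
  + exists (inv w), (inv y), (inv x); split; first exact: T_rev'.
    by apply: Or43; rewrite !gN; split => //; ring.
  + exists (inv w), (inv y), (inv x); split; first exact: T_rev'.
    by apply: Or42; rewrite !gN; split => //; ring.
(* The pair (p, q) determines y: otherwise the second triple is (x^-1,y^-1,w^-1), the case settled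
   by [T_sign]. *)
- have mid x y w x' y' w' : T x y w -> T x' y' w' ->
    - (g x + g y) = - (g x' + g y') -> - (g y + g w) = - (g y' + g w') -> y = y'.
    move=> t t' /oppr_inj exy /oppr_inj eyw.
    have [] := T_pr t t'.
    - by rewrite -!raddfD exy.
    - by rewrite -!raddfD eyw.
    move=> e1 e2 e3; case: (pr_inj e2) => // e2'.
    case: (pr_inj e1) => e1'.
      by move: exy; rewrite e1' => /addrI/g_inj.
    case: (pr_inj e3) => e3'.
      by move: eyw; rewrite e3' => /addIr/g_inj.
    rewrite e2'; apply/esym; apply: (T_sign t); first by rewrite -e1' -e2' -e3'.
    - by apply: dbl; move: exy; rewrite e1' e2' !gN.
    - by apply: dbl; move: eyw; rewrite e3' e2' !gN.
  move=> u v t t' [x [y [w [t1 h]]]] [x' [y' [w' [t1' h']]]].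
  (* Generators are odd while p and q are even, so parity excludes a common pair for entries of
     different kinds. *)
  case: h h' => -[-> -> ->] [] [e1 e2 ->];
    try (by exfalso; move: (congr1 (par \o pr) e1) (congr1 (par \o pr) e2);
            rewrite /= ?parN; first [move=> /par1|move=> /par1'|move=> _ /par1|move=> _ /par1']).
  + by move: e1 e2 t1' => /g_inj <- /g_inj <- /(T_fun t1) ->.
  + move: e1 e2 t1' => /g_inj <- /oppr_inj/addIr/g_inj <- /(T_fun t1) -> //.
  + by congr (g _); exact: mid t1 t1' e1 e2.
  + move: e2 e1 t1' => /g_inj <- /oppr_inj/addrI/g_inj <-.
    by move=> /T_rot/(T_fun (T_rot t1)) ->.
- move=> u v t [x [y [w [t1 h]]]].
  (* The removed triples through these pairs are (x,y,p), (y,p,x), (p,q,r) and (q,y,w). *)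
  case: h => -[-> -> _].
  + rewrite op1E ?par_g; last by left.
    by exists (- (g y + g w)), x, y, w; split=> //; apply: Or42.
  + rewrite op1E ?par_g; last by left.
    exists (- (g w + g x)), w, x, y; split; first exact: T_rot2.
    by apply: Or44; split=> //; ring.
  + rewrite (op1T _ _ _ t1).
    exists (g w), y, w, x; split; first exact: T_rot.
    by apply: Or43; split=> //; ring.
  + rewrite op1E ?par_g; last by right.
    exists (g x), y, w, x; split; first exact: T_rot.
    by apply: Or41; split=> //; ring.
move=> op [ipop opN opE]; exists op; split=> //.
- by move=> x y w t1; apply: opN; exists x, y, w; split=> //; apply: Or41.
have par2 j : par (pr (g j *+ 2)) = 0 by rewrite prg2 raddf0.
have z0 j x y w : T x y w -> g j *+ 2 <> - (g x + g y).
  move=> /T_cls n /(congr1 pr); rewrite prg2 raddfN raddfD /= EN => /esym/EK.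
  exact: n.
move=> j; split.
- rewrite opE ?op1E ?par_g ?mulr2n //; first by left.
  move=> [t [x [y [w [t1]]]]] [] [e1 e2 _].
  + by move: e1 e2 t1 => /g_inj <- /g_inj <- /T_cls.
  + by move: (congr1 (par \o pr) e2) => /=; rewrite parN => /par1.
  + by move: (congr1 (par \o pr) e1) => /=; rewrite parN => /par1.
  + by move: (congr1 (par \o pr) e1) => /=; rewrite parN => /par1.
- rewrite opE ?op1E ?par_g; [by ring|by right|].
  move=> [t [x [y [w [t1]]]]] [] [e1 e2 _].
  + by move: (congr1 (par \o pr) e1) => /=; rewrite par2 => /par1'.
  + by move: (congr1 (par \o pr) e1) => /=; rewrite par2 => /par1'.
  + exact: z0 t1 e1.
  + exact: z0 (T_rot t1) e1.
- rewrite opE ?op1E ?par_g; [by ring|by left|].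
  move=> [t [x [y [w [t1]]]]] [] [e1 e2 _].
  + by move: (congr1 (par \o pr) e2) => /=; rewrite par2 => /par1'.
  + exact: z0 t1 e2.
  + exact: z0 (T_rot t1) e2.
  + by move: (congr1 (par \o pr) e2) => /=; rewrite par2 => /par1'.
Qed.

(** * The last trade, for triples with a repeated entry *)

Variables (M : J -> J -> J -> Prop) (Z : J -> J -> Prop).
Hypothesis M_rot : forall x y w, M x y w -> M y w x.
Hypothesis M_rev : forall x y w, M x y w -> M (inv y) (inv x) (inv w).
Hypothesis M_fun : forall x y w w', M x y w -> M x y w' -> w = w'.
Hypothesis Z_rev : forall x y, Z x y -> Z (inv y) (inv x).
Hypothesis Z_fun : forall x y y', Z x y -> Z x y' -> y = y'.
Hypothesis Z_double : forall x y, Z x y -> g x *+ 2 = g y *+ 2.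
Hypothesis Z_neq0 : forall x y, Z x y -> g x *+ 2 <> 0.
Hypothesis M_Z : forall x y w, M x y w -> ~ Z x y.

Let defd x y := (exists w, M x y w) \/ Z x y.

(** These two hypotheses provide the rotation condition of [ip_op_trade]: each old triple through a
    filled pair is removed with all its pairs. *)
Hypothesis M_base : forall x y w, M x y w ->
  (x = y /\ exists v, Z v y) \/ (exists v, T x y v /\ defd y v).
Hypothesis Z_base : forall x y, Z x y ->
  [/\ exists w, M x x w, exists v, T x y v /\ defd y v & exists v, Z y v].

(** [M] gives inserted triples of generators; [Z x y] gives (z,x,y) and its rotations, where z = 2x
    = 2y. *)
Let power (u v t : A) : Prop :=
  (exists x y w, M x y w /\ [/\ u = g x, v = g y & t = g w]) \/
  exists x y, Z x y /\
    [\/ [/\ u = g x *+ 2, v = g x & t = g y], [/\ u = g x, v = g y & t = g x *+ 2]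
      | [/\ u = g y, v = g x *+ 2 & t = g x]].

Lemma power_op : exists op : A -> A -> A,
  [/\ ip_op op, (forall x y w, M x y w -> op (g x) (g y) = - g w)
    & (forall x y w, T x y w -> ~ defd x y -> op (g x) (g y) = - g w)].
Proof.
have [op2 [ip2 op2T op2z]] := pasch_op.
have gz x y : g x <> g y *+ 2.
  by move=> /(congr1 (par \o pr)); rewrite /= prg2 par_g raddf0.
have zg x y : g y *+ 2 <> g x by move=> /esym/gz.
have Z_inj x x' y : Z x y -> Z x' y -> x = x'.
  move=> /Z_rev z1 /Z_rev /(Z_fun z1) /(congr1 g).
  by rewrite !gN => /oppr_inj/g_inj.
have M_Z' x y w : M x y w -> Z x y -> False by exact: M_Z.
have [] := @ip_op_trade A op2 power.
- exact: ip2.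
- move=> u v t h u0.
  have g0 x : g x <> 0 by move=> /(congr1 (par \o pr)); rewrite /= par_g !raddf0.
  case: h => [[x [y [w [_ [e _ _]]]]]|[x [y [z [] [e _ _]]]]].
  + by apply: (g0 x); rewrite -e.
  + by apply: (Z_neq0 z); rewrite -e.
  + by apply: (g0 x); rewrite -e.
  + by apply: (g0 y); rewrite -e.
- move=> u v t [[x [y [w [m [-> -> ->]]]]]|[x [y [z h]]]].
    by left; exists y, w, x; split=> //; exact: M_rot.
  right; exists x, y; split=> //.
  by case: h => -[-> -> ->]; [apply: Or32|apply: Or33|apply: Or31].
- move=> u v t [[x [y [w [m [-> -> ->]]]]]|[x [y [z h]]]].
    by left; exists (inv y), (inv x), (inv w); split; [exact: M_rev|rewrite !gN].
  have zN a : - (g a *+ 2) = g a *+ 2 by apply: (eq4 (- g a)); ring.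
  right; exists (inv y), (inv x); split; first exact: Z_rev.
  rewrite !gN !mulNrn -(Z_double z) zN.
  by case: h => -[-> -> ->]; rewrite ?zN; [apply: Or33|apply: Or32|apply: Or31].
- move=> u v t t' [[x [y [w [m [-> -> ->]]]]]|[x [y [z h]]]]
    [[x' [y' [w' [m' [e1 e2 ->]]]]]|[x' [y' [z' h']]]].
  + by move: e1 e2 m' => /g_inj <- /g_inj <- /(M_fun m) ->.
  + case: h' => -[e1 e2 _]; [by case: (gz _ _ e1)| |by case: (gz _ _ e2)].
    by exfalso; move: e1 e2 z' => /g_inj <- /g_inj <-; exact: M_Z' m.
  + case: h e1 e2 => -[-> -> _] e1 e2; [by case: (zg _ _ e1)| |by case: (zg _ _ e2)].
    by exfalso; move: e1 e2 m' => /g_inj <- /g_inj <- /M_Z'; exact.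
  + case: h h' => -[-> -> ->] [] [e1 e2 ->];
      try (by case: (zg _ _ e1)); try (by case: (gz _ _ e1));
      try (by case: (zg _ _ e2)); try (by case: (gz _ _ e2)) => //.
    * by move: e2 z' => /g_inj <- /(Z_fun z) ->.
    * by move: e1 => /g_inj ->.
    * by move: e1 z' => /g_inj <- /(Z_inj _ _ _ z) ->.
have defdP x y : defd x y -> exists s, power (g x) (g y) s.
  case=> [[w m]|z]; first by exists (g w); left; exists x, y, w.
  by exists (g x *+ 2); right; exists x, y; split=> //; apply: Or32.
have TP x y : (exists v, T x y v /\ defd y v) ->
    exists s, power (g y) (- op2 (g x) (g y)) s.
  by move=> [v [t1 /defdP]]; rewrite (op2T _ _ _ t1) opprK.
- move=> u v t [[x [y [w [m [-> -> _]]]]]|[x [y [z h]]]].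
    case: (M_base m) => [[-> [x' z]]|/TP //].
    have [-> _ _] := op2z y; exists (g x'); right; exists x', y; split=> //.
    apply: Or33; split=> //.
    by rewrite (Z_double z); apply: (eq4 (- g y)); ring.
  have [/[dup] Mx [w m] Ty [v' z']] := Z_base z.
  (* The removed triples are (z,x,x), (x,y,v) and (y,z,y). *)
  case: h => -[-> -> _].
  + have [_ -> _] := op2z x.
    have -> : - (g x *+ 3) = g x by apply: (eq4 (- g x)); ring.
    by apply: defdP; left.
  + exact: TP.
  + have [_ _] := op2z y; rewrite (Z_double z) => ->.
    have -> : - (g y *+ 3) = g y by apply: (eq4 (- g y)); ring.
    by exists (g v'); right; exists y, v'; split=> //; apply: Or31.
move=> op [ipop opN opE]; exists op; split=> // x y w h.
  by apply: opN; left; exists x, y, w.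
move=> nd; rewrite opE ?(op2T _ _ _ h) // => -[t].
case=> [[x' [y' [w' [m [e1 e2 _]]]]]|[x' [y' [z' [] [e1 e2 _]]]]].
- by move: e1 e2 m nd => /g_inj <- /g_inj <- m; apply; left; exists w'.
- exact: gz e1.
- by move: e1 e2 z' nd => /g_inj <- /g_inj <- z'; apply; right.
- exact: gz e2.
Qed.

End Trades.

(** * Adjoining fresh elements *)

Section FreshCopies.

Variables (I : Type) (inv : I -> I) (T : I -> I -> I -> Prop) (o : I -> bool).
Hypothesis invK : involutive inv.
Hypothesis T_rot : forall x y w, T x y w -> T y w x.
Hypothesis T_rev : forall x y w, T x y w -> T (inv y) (inv x) (inv w).
Hypothesis T_fun : forall x y w w', T x y w -> T x y w' -> w = w'.
Hypothesis T_inv : forall x y w, T x y w -> y <> inv x.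
(* The trades (x,a,b) for [x] and (x^-1,a^-1,b^-1) for [inv x], when [T x x x],
   would use some pairs twice: [o] selects one of them. *)
Hypothesis o_inv : forall x, x <> inv x -> o (inv x) = ~~ o x.

(* [(x, None)] stands for [x]; [(x, Some _)] are the two fresh elements attached
   to [x]. *)
Let J := (I * option bool)%type.

Definition copy_inv (j : J) : J := (inv j.1, j.2).

(** The cyclic order x, a, b of the three copies, or its opposite, according to the boolean. *)
Definition turn (b : bool) (k : option bool) : option bool :=
  match b, k with
  | true, None => Some false | true, Some false => Some true | true, Some true => None
  | false, None => Some true | false, Some true => Some false | false, Some false => None
  end.

(** The triples realised by Pasch switches, whose entries lie in different classes. A triple (x,x,w)
    with w <> x is replaced by the rotations of (x,w,a) and (w,x,a), a triple (x,x,x) by those of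
    (x,a,b). *)
Inductive scaffold : J -> J -> J -> Prop :=
| Scaffold_old x y w of T x y w & x <> y & y <> w & w <> x :
    scaffold (x, None) (y, None) (w, None)
| Scaffold_xwa x w of T x x w & w <> x :
    scaffold (x, None) (w, None) (x, Some false)
| Scaffold_wax x w of T x x w & w <> x :
    scaffold (w, None) (x, Some false) (x, None)
| Scaffold_axw x w of T x x w & w <> x :
    scaffold (x, Some false) (x, None) (w, None)
| Scaffold_wxa x w of T x x w & w <> x :
    scaffold (w, None) (x, None) (x, Some false)
| Scaffold_xaw x w of T x x w & w <> x :
    scaffold (x, None) (x, Some false) (w, None)
| Scaffold_awx x w of T x x w & w <> x :
    scaffold (x, Some false) (w, None) (x, None)
| Scaffold_cube x k of T x x x :
    scaffold (x, k) (x, turn (o x) k) (x, turn (o x) (turn (o x) k)).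

(* [square] and [arrow] describe the triples inserted by the last trade: those of
   three copies, and the triples (z, j, k) with z = 2 j = 2 k. *)
Inductive square : J -> J -> J -> Prop :=
| Square_xxw x w k of T x x w & w <> x & k <> Some true :
    square (x, k) (x, k) (w, None)
| Square_xwx x w k of T x x w & w <> x & k <> Some true :
    square (x, k) (w, None) (x, k)
| Square_wxx x w k of T x x w & w <> x & k <> Some true :
    square (w, None) (x, k) (x, k)
| Square_cube x k of T x x x : square (x, k) (x, k) (x, k).

Inductive arrow : J -> J -> Prop :=
| Arrow_xa x w of T x x w & w <> x : arrow (x, None) (x, Some false)
| Arrow_ax x w of T x x w & w <> x : arrow (x, Some false) (x, None)
| Arrow_cube x k of T x x x : arrow (x, k) (x, turn (o x) k).

Let inv_inj x y : inv x = inv y -> x = y.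
Proof. exact: (can_inj invK). Qed.

Let T_ndiag x w : T x x w -> x <> inv x.
Proof. exact: T_inv. Qed.

Let turn_inv b k : turn (~~ b) (turn b k) = k.
Proof. by case: b k => -[[]|]. Qed.

Let turn3 b k : turn b (turn b (turn b k)) = k.
Proof. by case: b k => -[[]|]. Qed.

Let turnN b k : turn b (turn b k) = turn (~~ b) k.
Proof. by case: b k => -[[]|]. Qed.

Let turn_neq b k : turn b k <> k.
Proof. by case: b k => -[[]|]. Qed.

Let T_xwx x y w : T x y w -> T w x y.
Proof. by move=> /T_rot/T_rot. Qed.

Ltac collapse :=
  repeat match goal with
  | h : T ?x ?y ?a, h' : T ?x ?y ?b |- _ =>
      match a with b => fail 1 | _ => have ? := T_fun h h'; subst end
  | h : T ?x ?y ?w |- _ =>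
      match goal with _ : T y w x |- _ => fail 1 | _ => have ? := T_rot h end
  end.

Ltac split_turns :=
  repeat match goal with
  | k : option bool |- _ => destruct k as [[]|]
  | _ : context [turn (o ?x) _] |- _ => destruct (o x)
  | |- context [turn (o ?x) _] => destruct (o x)
  end; simpl in *.

Lemma scaffold_rot x y w : scaffold x y w -> scaffold y w x.
Proof.
case=> {x y w}; try (by move=> x w t n; econstructor; eassumption).
  by move=> x y w /T_rot t *; constructor.
by move=> x k Tx; have := Scaffold_cube (turn (o x) k) Tx; rewrite turn3.
Qed.

Lemma scaffold_rev x y w :
  scaffold x y w -> scaffold (copy_inv y) (copy_inv x) (copy_inv w).
Proof.
case=> {x y w}; rewrite /copy_inv /=; try by
  move=> x w /T_rev t n; constructor=> // /inv_inj.
  move=> x y w /T_rev t n1 n2 n3; constructor=> // /inv_inj //; congruence.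
move=> x k Tx; have e := o_inv (T_ndiag Tx).
have := Scaffold_cube (turn (o x) k) (T_rev Tx).
by rewrite e turn_inv -[in turn (~~ o x) k]turnN.
Qed.

Lemma scaffold_fun x y w w' : scaffold x y w -> scaffold x y w' -> w = w'.
Proof.
move=> h h'; inversion h; subst; inversion h'; subst; try congruence;
  collapse; try congruence;
  split_turns; try congruence.
Qed.

Lemma scaffold_neq x y w : scaffold x y w -> ~ (y = x \/ y = copy_inv x).
Proof.
case=> {x y w} => [x y w t n _ _|x w t n|x w t n|x w t n|x w t n|x w t n|x w t n|x k t];
  rewrite /copy_inv => -[] [] //=.
- by move=> /esym.
- exact: T_inv t.
- exact: T_inv (T_rot t).
- by move=> /esym.
- exact: T_inv (T_xwx t).
- exact: turn_neq.
- by move=> _; exact: turn_neq.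
Qed.

(** Only the triples (x,a,b) of a cube have all entries over x or [inv x]. Changing signs keeps
    their direction, whereas [o] demands the opposite one at [inv x]. *)
Lemma scaffold_sign x y w :
  scaffold x y w -> scaffold (copy_inv x) (copy_inv y) (copy_inv w) ->
  y.1 = x.1 \/ y.1 = inv x.1 -> w.1 = y.1 \/ w.1 = inv y.1 -> False.
Proof.
move=> h h' [e1|e1] [e2|e2]; inversion h; subst; simpl in *; try congruence;
  try (by have := T_inv H; rewrite -?e1 -?e2; congruence);
  try (by have := T_inv (T_rot H); rewrite -?e1 -?e2; congruence);
  try (by have := T_inv (T_xwx H); rewrite -?e1 -?e2; congruence).
inversion h'; subst; try congruence; try (by split_turns; congruence).
have e := o_inv (T_ndiag H); split_turns; try congruence.
Qed.

Lemma square_rot x y w : square x y w -> square y w x.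
Proof.
case=> {x y w}; try (by move=> x w k t n nk; econstructor; eassumption).
by move=> *; constructor.
Qed.

Lemma square_rev x y w :
  square x y w -> square (copy_inv y) (copy_inv x) (copy_inv w).
Proof.
by case=> {x y w}; rewrite /copy_inv /=; first [
  move=> x w k /T_rev t n nk; constructor=> // /inv_inj|
  move=> x k /T_rev t; constructor].
Qed.

Lemma square_fun x y w w' : square x y w -> square x y w' -> w = w'.
Proof.
move=> h h'; inversion h; subst; inversion h'; subst; try congruence;
  collapse; congruence.
Qed.

Lemma arrow_rev x y : arrow x y -> arrow (copy_inv y) (copy_inv x).
Proof.
case=> {x y}; rewrite /copy_inv /=; try by
  move=> x w /T_rev t n; econstructor; [exact: t|move=> /inv_inj].
move=> x k Tx; have e := o_inv (T_ndiag Tx).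
have := Arrow_cube (turn (o x) k) (T_rev Tx).
by rewrite e turn_inv.
Qed.

Lemma arrow_fun x y y' : arrow x y -> arrow x y' -> y = y'.
Proof.
move=> h h'; inversion h; subst; inversion h'; subst; try congruence;
  collapse; congruence.
Qed.

Lemma arrow_neq x y : arrow x y -> x.1 = y.1 /\ x.1 <> inv x.1.
Proof. by case=> {x y} x *; split=> //=; apply: T_ndiag; eassumption. Qed.

Lemma square_arrow x y w : square x y w -> ~ arrow x y.
Proof.
move=> h h'; inversion h; subst; inversion h'; subst; try congruence;
  collapse; try congruence; split_turns; congruence.
Qed.

Let filled x y := (exists w, square x y w) \/ arrow x y.

Lemma square_base x y w : square x y w ->
  (x = y /\ exists v, arrow v y) \/ (exists v, scaffold x y v /\ filled y v).
Proof.
have fs a b c : square a b c -> filled a b by left; exists c.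
case=> {x y w}.
- move=> x w [[]|] // t n _; left; split=> //.
    by exists (x, None); apply: Arrow_xa t n.
  by exists (x, Some false); apply: Arrow_ax t n.
- move=> x w [[]|] // t n _; right.
    exists (x, None); split; first by apply: Scaffold_awx.
    by apply: (fs _ _ (x, None)); apply: Square_wxx.
  exists (x, Some false); split; first by apply: Scaffold_xwa.
  by apply: (fs _ _ (x, Some false)); apply: Square_wxx.
- move=> x w [[]|] // t n _; right.
    exists (x, None); split; first by apply: Scaffold_wax.
    by right; apply: Arrow_ax t n.
  exists (x, Some false); split; first by apply: Scaffold_wxa.
  by right; apply: Arrow_xa t n.
- move=> x k t; left; split=> //; exists (x, turn (~~ o x) k).
  have := Arrow_cube (turn (~~ o x) k) t.
  by have := turn_inv (~~ o x) k; rewrite negbK => ->.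
Qed.

Lemma arrow_base x y : arrow x y ->
  [/\ exists w, square x x w, exists v, scaffold x y v /\ filled y v
    & exists v, arrow y v].
Proof.
have fs a b c : square a b c -> filled a b by left; exists c.
case=> {x y}.
- move=> x w t n; split.
  + by exists (w, None); apply: Square_xxw.
  + exists (w, None); split; first exact: Scaffold_xaw.
    by apply: (fs _ _ (x, Some false)); apply: Square_xwx.
  + by exists (x, None); apply: Arrow_ax t n.
- move=> x w t n; split.
  + by exists (w, None); apply: Square_xxw.
  + exists (w, None); split; first exact: Scaffold_axw.
    by apply: (fs _ _ (x, None)); apply: Square_xwx.
  + by exists (x, Some false); apply: Arrow_xa t n.
- move=> x k t; split.
  + by exists (x, k); apply: Square_cube.
  + exists (x, turn (o x) (turn (o x) k)); split; first exact: Scaffold_cube.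
    by right; apply: Arrow_cube.
  + by exists (x, turn (o x) (turn (o x) k)); apply: Arrow_cube.
Qed.

(** Triples with a repeated entry are inserted by the last trade; the others come from the Pasch
    switches, and the last trade does not touch their pairs. *)
Lemma old_cases x y w : T x y w ->
  square (x, None) (y, None) (w, None) \/
  scaffold (x, None) (y, None) (w, None) /\ ~ filled (x, None) (y, None).
Proof.
move=> t; have [?|nxy] := pselect (x = y).
  subst; left; have [?|n] := pselect (w = y); first by subst; apply: Square_cube.
  by apply: Square_xxw.
have [?|nyw] := pselect (y = w).
  by subst; left; apply: Square_wxx => //; apply: T_rot.
have [?|nwx] := pselect (w = x).
  by subst; left; apply: Square_xwx => //; exact: T_xwx.
right; split; first exact: Scaffold_old.
by move=> [[? h]|h]; inversion h; subst; collapse; congruence.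
Qed.

End FreshCopies.

(** * Algebra of finite function groups and their products *)

HB.instance Definition _ (I : finType) (R : comPzRingType) :=
  GRing.PzRing_hasCommutativeMul.Build {ffun I -> R} (@ffun_mulC I R).

Lemma pair_mulrn (U V : zmodType) (u : U * V) n : u *+ n = (u.1 *+ n, u.2 *+ n).
Proof. by elim: n => // n IH; rewrite !mulrS IH. Qed.

Definition ffun_sum (K : finType) (R : zmodType) (u : {ffun K -> R}) : R :=
  \sum_k u k.

Lemma ffun_sum_is_additive (K : finType) (R : zmodType) :
  zmod_morphism (@ffun_sum K R).
Proof.
by move=> u v; rewrite /ffun_sum -sumrB; apply: eq_bigr => k _; rewrite !ffunE.
Qed.

HB.instance Definition _ (K : finType) (R : zmodType) :=
  GRing.isZmodMorphism.Build _ _ (@ffun_sum K R) (@ffun_sum_is_additive K R).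

(** * The model *)

Section Model.

Variables (I : finType) (inv : I -> I).
Hypothesis invK : involutive inv.

Let K := ({set I} * option bool)%type.
Let A := ({ffun I -> 'Z_4} * {ffun K -> 'Z_2})%type.
Let E := {ffun K -> 'Z_2}.

(** Odd under [inv] without a choice of representatives for the classes {x, x^-1}; it vanishes when
    [inv x = x]. *)
Definition orient (x : I) : {ffun I -> 'Z_4} :=
  [ffun i => (i == x)%:R - (i == inv x)%:R].

Definition unit_at (k : K) : E := [ffun i => (i == k)%:R].

(** The first component ignores the copy, so all copies of x have the same double; the second
    records the class and the copy. *)
Definition gen (j : I * option bool) : A :=
  (orient j.1, unit_at ([set j.1; inv j.1], j.2)).

Let A4 (u : A) : u *+ 4 = 0.
Proof.
have z4 (a : 'Z_4) : a *+ 4 = 0 by rewrite -mulr_natr pchar_Zp ?mulr0.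
have z2 (a : 'Z_2) : a *+ 4 = 0.
  by rewrite -mulr_natr -[4%N]/(2 * 2)%N natrM pchar_Zp // !mulr0.
rewrite pair_mulrn; congr pair; apply/ffunP => i.
  by rewrite ffunMnE z4 ffunE.
by rewrite ffunMnE z2 ffunE.
Qed.

Let E2 (e : E) : e + e = 0.
Proof.
apply/ffunP => i; rewrite !ffunE -mulr2n -mulr_natr.
by rewrite (pchar_Zp (isT : 1 < 2)%N) mulr0.
Qed.

Let classC x : [set inv x; inv (inv x)] = [set x; inv x].
Proof. by rewrite invK setUC. Qed.

Let genN j : gen (copy_inv inv j) = - gen j.
Proof.
case: j => x k; congr pair; last first.
  by rewrite /= classC; apply/eqP; rewrite -addr_eq0 E2.
by apply/ffunP => i; rewrite !ffunE /= invK opprB.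
Qed.

Let unit_at_inj : injective unit_at.
Proof.
move=> a b /ffunP/(_ a); rewrite !ffunE eqxx.
by case: eqP.
Qed.

Let gen_pr j k : (gen j).2 = (gen k).2 -> k = j \/ k = copy_inv inv j.
Proof.
case: j k => x a [y b] /unit_at_inj [/setP/(_ y) + ->] /=.
by rewrite !inE eqxx orTb => /orP[]/eqP->; [left|right].
Qed.

Let orient_diag x : x <> inv x -> orient x x = 1.
Proof. by move=> /eqP/negPf n; rewrite ffunE eqxx n subr0. Qed.

Let gen_inj : injective gen.
Proof.
move=> j k /[dup] e /(congr1 snd)/gen_pr[//|ek].
move: e; rewrite ek genN => /(congr1 fst) /ffunP/(_ j.1).
rewrite !ffunE eqxx; case: eqP => [ej _|n].
  by case: j ej {ek} => x b /= {1}->.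
by move/eqP; rewrite subr0.
Qed.

Let sum_gen j : ffun_sum (gen j).2 = 1 :> 'Z_2.
Proof.
rewrite /ffun_sum (bigD1 ([set j.1; inv j.1], j.2)) //= ffunE eqxx big1 ?addr0 //.
by move=> i /negPf n; rewrite ffunE n.
Qed.

(** Over Z_2 a sum of two distinct unit vectors determines them: its coordinates at their two
    positions suffice. *)
Let gen_sum i j i' j' :
  (gen i).2 + (gen j).2 = (gen i').2 + (gen j').2 -> (gen i).2 <> (gen j).2 ->
  ((gen i).2 = (gen i').2 /\ (gen j).2 = (gen j').2) \/
  ((gen i).2 = (gen j').2 /\ (gen j).2 = (gen i').2).
Proof.
rewrite /gen /=; move: (_, i.2) (_, j.2) (_, i'.2) (_, j'.2) => a b c d e n.
have nab : (a == b) = false by apply/eqP => h; apply: n; rewrite h.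
move/ffunP: e => e; move: (e a) (e b); rewrite !ffunE !eqxx (eq_sym b a) nab.
case: (eqVneq a c) => [<-|_].
  by rewrite (eq_sym b a) nab; case: (eqVneq b d) => [->|]; left.
case: (eqVneq a d) => [<-|//].
by rewrite (eq_sym b a) nab; case: (eqVneq b c) => [->|]; right.
Qed.

Let orient_double x : orient x *+ 2 = 0 -> inv x = x.
Proof.
move=> /ffunP/(_ x); have [//|n] := eqVneq (inv x) x.
by rewrite ffunMnE orient_diag ?ffunE // => /esym/eqP; rewrite (negPf n).
Qed.

(** If x is not its own inverse, 2 [orient x] is nonzero at x, while [orient y] is supported on y
    and [inv y]. *)
Let gen_double x k y l : gen (x, k) *+ 2 = gen (y, l) *+ 2 ->
  [\/ inv x = x /\ inv y = y, y = x | y = inv x].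
Proof.
rewrite !pair_mulrn => -[/ffunP e _].
have [yx|nyx] := eqVneq y x; first exact: Or32.
have [yx|nyx'] := eqVneq y (inv x); first exact: Or33.
apply: Or31; split; apply/eqP/negPn/negP => n.
  move: (e x); rewrite !ffunMnE orient_diag; last by apply/eqP; rewrite eq_sym.
  by rewrite ffunE -(can2_eq invK invK) !(eq_sym _ y) (negPf nyx) (negPf nyx').
move: (e y); rewrite !ffunMnE orient_diag; last by apply/eqP; rewrite eq_sym.
by rewrite ffunE (negPf nyx) (negPf nyx').
Qed.

Variables (T : I -> I -> I -> Prop) (o : I -> bool).
Hypothesis T_rot : forall x y w, T x y w -> T y w x.
Hypothesis T_rev : forall x y w, T x y w -> T (inv y) (inv x) (inv w).
Hypothesis T_fun : forall x y w w', T x y w -> T x y w' -> w = w'.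
Hypothesis T_inv : forall x y w, T x y w -> y <> inv x.
Hypothesis o_inv : forall x, x <> inv x -> o (inv x) = ~~ o x.

Let gen_sign x y w :
  scaffold T o x y w ->
  scaffold T o (copy_inv inv x) (copy_inv inv y) (copy_inv inv w) ->
  gen x *+ 2 = gen y *+ 2 -> gen y *+ 2 = gen w *+ 2 -> copy_inv inv y = y.
Proof.
case: x y w => x i [y j] [w k] h h' /gen_double exy /gen_double eyw.
have cE : inv y = y -> copy_inv inv (y, j) = (y, j) by rewrite /copy_inv => /= ->.
have contra := scaffold_sign invK T_rot T_inv o_inv h h'.
case: exy => [[_ /cE]|exy|exy] //; case: eyw => [[/cE]|eyw|eyw] //;
  by case: contra => /=; tauto.
Qed.

Lemma partial_ip_loop_embedding :
  exists (op : A -> A -> A) (f : I -> A),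
    [/\ ip_op op, injective f, (forall x, f x <> 0), (forall x, f (inv x) = - f x)
      & (forall x y w, T x y w -> op (f x) (f y) = - f w)].
Proof.
have cls x y w (h : scaffold T o x y w) : (gen x).2 <> (gen y).2.
  by move=> /gen_pr; exact: (scaffold_neq T_rot T_inv h).
have Z_double x y : arrow T o x y -> gen x *+ 2 = gen y *+ 2.
  by move=> /(arrow_neq T_inv) [e _]; rewrite !pair_mulrn /gen /= e !mulr2n !E2.
have Z_neq0 x y : arrow T o x y -> gen x *+ 2 <> 0.
  move=> /(arrow_neq T_inv) [_ n]; rewrite pair_mulrn => -[/orient_double e _].
  exact/n/esym.
have [op [ipop opS opT]] := @power_op A E snd (@ffun_sum K 'Z_2) _ (copy_inv inv) gen
  A4 E2 genN gen_inj sum_gen gen_pr gen_sum (scaffold T o)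
  (scaffold_rot T_rot) (scaffold_rev invK T_rev T_inv o_inv)
  (scaffold_fun T_rot T_fun) cls gen_sign (square T) (arrow T o)
  (@square_rot _ _) (square_rev invK T_rev) (square_fun T_rot T_fun)
  (arrow_rev invK T_rev T_inv o_inv) (arrow_fun T_fun) Z_double Z_neq0
  (@square_arrow _ _ _) (@square_base _ _ _) (@arrow_base _ _ _).
exists op, (fun x => gen (x, None)); split=> //.
- by move=> x y /gen_inj [].
- move=> x e; have := sum_gen (x, None); rewrite e /ffun_sum big1 // => i _.
  by rewrite ffunE.
- by move=> x; rewrite -genN.
- move=> x y w /(old_cases o T_rot T_fun) [/opS //|[t n]].
  exact: opT t n.
Qed.

End Model.

(** * From a finite subset of an IP loop to the model *)

Lemma ip_op_is_IP_loop (A : zmodType) (op : A -> A -> A) :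
  ip_op op -> Defs.is_IP_loop op.
Proof.
move=> [ip0 ip]; split; first split; first by exists 0.
- split=> a b.
    exists (op (- a) b); split; first by rewrite -{1}[a]opprK (ip (- a) b).1.
    by move=> x <-; rewrite (ip a x).1.
  exists (op b (- a)); split; first by rewrite -{2}[a]opprK (ip (- a) b).2.
  by move=> x <-; rewrite (ip a x).2.
- exists 0; split=> // x; exists (- x).
  split; first by have := (ip x 0).2; rewrite (ip0 x).1.
  by split; first by have := (ip x 0).1; rewrite (ip0 x).2.
Qed.

Lemma ip_loop_FEP (G : choiceType) (m : G -> G -> G) (e : G) (iv : G -> G) (X : seq G) :
  (forall x, m e x = x /\ m x e = x) ->
  (forall x, m x (iv x) = e /\ m (iv x) x = e) ->
  (forall x y, m (iv x) (m x y) = y /\ m (m y x) (iv x) = y) ->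
  exists (H : finType) (mH : H -> H -> H) (f : G -> H),
    [/\ Defs.is_IP_loop mH, {in X &, injective f}
      & {in X &, forall x y, m x y \in X -> f (m x y) = mH (f x) (f y)}].
Proof.
move=> me miv mip.
have ivK x : iv (iv x) = x.
  by have := (mip (iv x) x).1; rewrite (miv x).2 (me _).2.
pose N := [seq y <- X ++ map iv X | y != e].
have ive x : iv x = e -> x = e by move=> h; rewrite -(miv x).1 h (me x).2.
have NP x : x \in N -> iv x \in N.
  rewrite !mem_filter !mem_cat => /andP[xe xX]; apply/andP; split.
    by apply/eqP => /ive /eqP; rewrite (negPf xe).
  case/orP: xX => [xX|/mapP [y yX ->]]; first by rewrite (map_f iv xX) orbT.
  by rewrite ivK yX.
pose I : finType := seq_sub N.
pose inv (x : I) : I := SeqSub (NP _ (valP x)).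
pose T (x y w : I) := m (val x) (val y) = iv (val w).
(* The position in the list [N] selects one element of each pair of distinct mutual inverses. *)
pose o (x : I) := (index (val x) N < index (val (inv x)) N)%N.
have T_rot x y w : T x y w -> T y w x.
  rewrite /T => t; have := (mip (val x) (val y)).1; rewrite t.
  by move=> h; have := (mip (iv (val w)) (iv (val x))).2; rewrite h ivK.
have T_rev x y w : T x y w -> T (inv y) (inv x) (inv w).
  move=> /[dup] t /T_rot/T_rot; rewrite /T /= ivK => h.
  have := (mip (val x) (val w)).2; rewrite h => <-.
  by [].
have T_fun x y w w' : T x y w -> T x y w' -> w = w'.
  by rewrite /T => -> /(congr1 iv); rewrite !ivK => /val_inj.
have Ne (x : I) : val x <> e.
  by have := valP x; rewrite mem_filter => /andP[/eqP].
have T_inv x y w : T x y w -> y <> inv x.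
  move=> t yx; move: t; rewrite /T yx /= (miv _).1 => /esym/ive; exact: Ne.
have invK : involutive inv by move=> x; apply: val_inj; rewrite /= ivK.
have o_inv x : x <> inv x -> o (inv x) = ~~ o x.
  move=> n; rewrite /o invK -leqNgt [RHS]leq_eqVlt.
  case: eqP => // /(congr1 (nth e N)); rewrite !nth_index ?ssvalP //.
  by move=> h; case: n; apply: val_inj.
have [op [f [ipop f_inj f0 fN fT]]] :=
  @partial_ip_loop_embedding I inv invK T o T_rot T_rev T_fun T_inv o_inv.
(* The default 0 is the right value at [e], which [N] omits. *)
pose F (x : G) := if insub x is Some i then f i else 0.
have F0 : F e = 0.
  by rewrite /F insubF // mem_filter eqxx.
have FI (i : I) : F (val i) = f i by rewrite /F valK.
have XN x : x \in X -> x = e \/ exists i : I, x = val i.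
  move=> xX; have [->|xe] := eqVneq x e; first by left.
  right; have xN : x \in N by rewrite mem_filter xe mem_cat xX.
  by exists (SeqSub xN).
eexists; exists op, F; split.
- exact: ip_op_is_IP_loop.
- move=> x y /XN[->|[i ->]] /XN[->|[j ->]]; rewrite ?F0 ?FI //.
  + by move=> /esym/f0.
  + by move=> /f0.
  + by move=> /f_inj ->.
- have [ip0 ip] := ipop.
  move=> x y /XN[->|[i ->]] /XN[->|[j ->]]; rewrite ?F0 ?FI ?(me _).1 ?(me _).2
    ?(ip0 _).1 ?(ip0 _).2 ?F0 ?FI //.
  (* A product equal to [e] forces y = x^-1; any other product in [X] gives a triple of [T]. *)
  move=> /XN[xy|[k xy]]; rewrite xy.
    have -> : j = inv i.
      by apply: val_inj; rewrite /= -[LHS](mip (val i) _).1 xy (me _).2.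
    by rewrite F0 fN; have := (ip (f i) 0).2; rewrite (ip0 _).1.
  have t : T i j (inv k) by rewrite /T /= ivK.
  by rewrite FI (fT _ _ _ t) fN opprK.
Qed.

(* Imported only here, as [List.seq] hides the type [seq]. *)
Require Import Defs.
From Stdlib Require Import List FinFun.

(** * Transfer to arbitrary types and list membership *)

Lemma In_mem (T : eqType) (x : T) (s : list T) : In x s <-> x \in s.
Proof.
elim: s => //= y s IH; rewrite inE; split.
  by move=> [->|/IH ->]; rewrite ?eqxx ?orbT.
by move=> /orP[/eqP->|/IH]; [left|right].
Qed.

Theorem theorem1 (G : Type) (m : G -> G -> G) (HG : is_IP_loop m)
    (X : list G) (HX : X <> []) :
  exists (H : Type) (mH : H -> H -> H) (f : G -> H),
    Finite H /\ is_IP_loop mH /\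
    (forall x y, In x X -> In y X -> f x = f y -> x = y) /\
    (forall x y, In x X -> In y X -> In (m x y) X ->
       f (m x y) = mH (f x) (f y)).
Proof.
(* Choice yields an inversion function, and [{classic G}] supplies the decidable equality used for
   lists. *)
have [_ [e [me /choice [iv miv]]]] := HG.
have [H [mH [f [ipH f_inj fM]]]] := @ip_loop_FEP {classic G} m e iv X me
  (fun x => conj (miv x).1 (miv x).2.1) (fun x => (miv x).2.2).
have mem x : In x X -> x \in (X : list {classic G}) by move=> /(@In_mem {classic G}).
exists H, mH, f; split; first by exists (enum H) => x; apply/In_mem; rewrite mem_enum.
split=> //; split=> [x y /mem xX /mem yX|x y /mem xX /mem yX /mem]; first exact: f_inj.
exact: fM.
Qed.
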